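(* Let $G$ be a connected graph and let $\widetilde{\Delta}(G)$ denote the maximum degree of a vertex of $G$ which is an endpoint of a bridge of $G$. Then $tpc(G)\leq\widetilde{\Delta}(G)+1$ if $\widetilde{\Delta}(G)\geq 4$, and $tpc(G)\leq 4$ otherwise.
   Context: All graphs are simple, finite and undirected. A graph is total-colored if every vertex and every edge receives a color. A path $v_1v_2\ldots v_s$ in a total-colored graph is a total proper path if (i) any two adjacent edges on the path have different colors, (ii) any two adjacent internal vertices of the path (vertices among $v_2,\ldots,v_{s-1}$) have different colors, and (iii) every internal vertex of the path has a color different from the colors of its two incident edges on the path. A total-colored graph is total proper connected if every two vertices are joined by a total proper path. For a connected graph $G$, the total proper connection number $tpc(G)$ is the smallest number of colors in a total-coloring making $G$ total proper connected. If $G$ has no bridge, $\widetilde{\Delta}(G)$ is taken to be $0$. *)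

(* Defs.v *)
From mathcomp Require Import all_boot.
From mathcomp Require Import boolp.

Set Implicit Arguments.
Unset Strict Implicit.
Unset Printing Implicit Defensive.

Record sgraph := SGraph {
  svertex :> finType;
  sedge : rel svertex;
  sedge_sym : symmetric sedge;
  sedge_irrefl : irreflexive sedge }.

Definition gconnected (G : sgraph) : Prop :=
  0 < #|G| /\ forall x y : G, connect (@sedge G) x y.

Definition degree (G : sgraph) (x : G) : nat := #|[set y | sedge x y]|.

Definition del_edge (G : sgraph) (u v : G) : rel G :=
  [rel x y | sedge x y && ([set x; y] != [set u; v])].

Definition bridge (G : sgraph) (u v : G) : bool :=
  sedge u v && (n_comp (@sedge G) predT < n_comp (del_edge u v) predT).

(* The maximum over an empty family is 0, so this is 0 when G is bridgeless. *)
Definition bridge_max_degree (G : sgraph) : nat :=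
  \max_(v : G | [exists w, bridge v w]) degree v.

(* A total-colouring with colours in C. The edge {x, y} is coloured by
   ecol [set x; y]; the values of ecol on sets that are not edges are
   never used. *)
Record total_coloring (G : sgraph) (C : eqType) := TotalColoring {
  vcol : G -> C;
  ecol : {set G} -> C }.

(* The path has vertex sequence v 0, v 1, ..., v (s - 1) with s = size (x :: p);
   its internal vertices are the v i with 0 < i < s - 1. *)
Definition total_proper_path (G : sgraph) (C : eqType)
    (c : total_coloring G C) (x : G) (p : seq G) : Prop :=
  let s := size (x :: p) in
  let v i := nth x (x :: p) i in
  [/\ path (@sedge G) x p && uniq (x :: p),
      forall i, i.+2 < s ->
        ecol c [set v i; v i.+1] != ecol c [set v i.+1; v i.+2],
      forall i, 0 < i -> i.+2 < s -> vcol c (v i) != vcol c (v i.+1) &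
      forall i, i.+2 < s ->
        vcol c (v i.+1) != ecol c [set v i; v i.+1] /\
        vcol c (v i.+1) != ecol c [set v i.+1; v i.+2]].

Definition total_proper_connected (G : sgraph) (C : eqType)
    (c : total_coloring G C) : Prop :=
  forall x y : G, x != y ->
    exists p, last x p = y /\ total_proper_path c x p.

Definition tpc_colorable (G : sgraph) (k : nat) : Prop :=
  exists c : total_coloring G 'I_k, total_proper_connected c.

Lemma set2_uniq3 (T : finType) (a b d : T) :
  a != b -> a != d -> [set a; b] != [set b; d].
Proof.
move=> ab ad; apply/eqP => /setP /(_ a).
by rewrite !inE eqxx (negPf ab) (negPf ad).
Qed.

Lemma tpc_colorable_ex (G : sgraph) :
  gconnected G -> exists k, `[< tpc_colorable G k >].
Proof.
move=> [_ conn]; exists #|{: G + {set G}}|; apply/asboolP.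
exists (TotalColoring (fun x : G => enum_rank (inl x : G + {set G}))
                      (fun A : {set G} => enum_rank (inr A : G + {set G}))).
move=> x y _; have /connectP[q eq_path ->] := conn x y.
case/shortenP: eq_path => p p_path p_uniq _.
have neq_v i j : i < j -> j < size (x :: p) ->
    nth x (x :: p) i != nth x (x :: p) j.
  by move=> ltij ltj; rewrite nth_uniq // ?(ltn_trans ltij) // neq_ltn ltij.
exists p; split=> //; split; first by rewrite p_path.
- move=> i lti; rewrite /ecol (inj_eq enum_rank_inj) (inj_eq (@inr_inj _ _)).
  by apply: set2_uniq3; apply: neq_v => //; apply: ltnW.
- move=> i _ lti; rewrite /vcol (inj_eq enum_rank_inj) (inj_eq (@inl_inj _ _)).
  by apply: neq_v => //; apply: ltnW.
- by move=> i _; rewrite /vcol /ecol !(inj_eq enum_rank_inj).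
Qed.

Definition tpc (G : sgraph) (hG : gconnected G) : nat :=
  ex_minn (tpc_colorable_ex hG).

(* Main.v *)
Require Import Defs.
From mathcomp Require Import all_boot.
From mathcomp Require Import boolp perm.

(** In a bridgeless component, four colours suffice for a stronger property:
    any two vertices are joined by two paths, proper also at their end vertices,
    whose first edges differ and whose last edges differ. This survives the
    addition of an ear (open or closed) coloured so that, together with a path
    between its ends, it forms a properly coloured cycle [K]: a path from outside
    that reaches [K] arrives with an edge that allows it to go on along [K] in at
    least one of the two directions.

    A bridge ab is removed, and both sides are coloured by induction. Since the
    degrees of a and b are smaller than the number of colours, at each of them
    some colour is used neither by the vertex nor by its remaining edges. After
    permuting the colours on the side of b these two colours coincide, and give
    the colour of ab. *)

Set Implicit Arguments.
Unset Strict Implicit.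
Unset Printing Implicit Defensive.

(** * Paths that are proper also at their ends: concatenation, cutting, reversal *)

Section FullyProperPaths.
Variables (T : finType) (C : eqType) (e : rel T).
Variables (vc : T -> C) (ec : T -> T -> C).

(* A path all of whose edges are good and whose consecutive edges differ in
   colour satisfies the three conditions of a total proper path with its two
   end vertices treated as internal, so such paths can be concatenated as soon
   as the two edges at the junction differ. *)
Definition good_edge : rel T :=
  [rel x y | [&& e x y, vc x != vc y, ec x y != vc x & ec x y != vc y]].

Definition neqr : rel C := fun a b => a != b.

Definition proper_path x p :=
  [&& path good_edge x p, uniq (x :: p) & sorted neqr (pairmap ec x p)].

Definition joined x y := exists2 p, proper_path x p & last x p = y.

(* [a] and [b] are the colours of the first and of the last edge. *)
Definition linked (S : {set T}) x y a b := exists p,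
  [/\ proper_path x p, last x p = y, {subset x :: p <= S},
      ohead (pairmap ec x p) = Some a & ohead (rev (pairmap ec x p)) = Some b].

(** The property that is grown ear by ear. The two paths may overlap: only the colours at their ends
    matter. Keeping them inside [A] allows them to be continued by vertices outside [A]. *)
Definition strong (A : {set T}) := forall x y, x \in A -> y \in A -> x != y ->
  exists a b c d, [/\ linked A x y a b, linked A x y c d, a != c & b != d].

Definition cycle_colors c :=
  if c is x :: c' then pairmap ec x (rcons c' x) else [::].

Definition proper_cycle c :=
  [&& uniq c, cycle good_edge c & cycle neqr (cycle_colors c)].

Lemma neqr_sym : symmetric neqr.
Proof. by move=> a b; rewrite /neqr eq_sym. Qed.

Lemma linked_joined S x y a b : linked S x y a b -> joined x y.
Proof. by case=> p [tp lp _ _ _]; exists p. Qed.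

Lemma linked_sub (S S' : {set T}) x y a b :
  S \subset S' -> linked S x y a b -> linked S' x y a b.
Proof.
move=> /subsetP sSS' [p [tp lp sp hp rp]]; exists p; split=> //.
by move=> z /sp /sSS'.
Qed.

Lemma sorted_neqr_cat s1 s2 :
  sorted neqr s1 -> sorted neqr s2 ->
  (forall a b, ohead (rev s1) = Some a -> ohead s2 = Some b -> a != b) ->
  sorted neqr (s1 ++ s2).
Proof.
case/lastP: s1 => [//|s1 a]; case: s2 => [|b s2]; first by rewrite cats0.
rewrite rev_rcons /= cat_rcons => h1 h2 /(_ a b erefl erefl); rewrite -/(neqr a b) => nab.
case: s1 h1 => [|c s1] /=; first by rewrite nab.
by rewrite rcons_path cat_path /= h2 nab => /andP[-> ->].
Qed.

Lemma proper_path_cat x p q :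
  proper_path x p -> proper_path (last x p) q -> [disjoint x :: p & q] ->
  (forall a b, ohead (rev (pairmap ec x p)) = Some a ->
     ohead (pairmap ec (last x p) q) = Some b -> a != b) ->
  proper_path x (p ++ q).
Proof.
move=> /and3P[pp up sp] /and3P[pq uq sq] dpq h; apply/and3P; split.
- by rewrite cat_path pp.
- rewrite -cat_cons cat_uniq up; move: uq; rewrite cons_uniq => /andP[_ ->]; rewrite andbT.
  by rewrite -disjoint_has disjoint_sym.
- by rewrite pairmap_cat; apply: sorted_neqr_cat.
Qed.

Lemma linked_cat (S S' : {set T}) x w y a b c d :
  linked S x w a b -> linked S' w y c d -> b != c ->
  S :&: S' \subset [set w] -> linked (S :|: S') x y a d.
Proof.
move=> [p [tp lp sp hp rp]] [q [tq lq sq hq rq]] nbc sub.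
exists (p ++ q); split.
- apply: proper_path_cat; rewrite ?lp //; last first.
    by move=> a0 b0; rewrite rp hq => -[<-] [<-].
  rewrite disjoint_has; apply/hasPn => z zp; apply/negP => zq.
  have : z \in S :&: S' by rewrite inE sp // sq // inE zq orbT.
  move/(subsetP sub); rewrite inE => /eqP zw.
  by case/and3P: tq; rewrite /= -zw zq.
- by rewrite last_cat lp.
- move=> z; rewrite -cat_cons mem_cat in_setU => /orP[/sp->//|zq].
  by rewrite (sq z) ?orbT // inE zq orbT.
- by rewrite pairmap_cat; case: (pairmap ec x p) hp.
- by rewrite pairmap_cat rev_cat lp; case: (rev (pairmap ec w q)) rq.
Qed.

(** Cutting at the first vertex in [D] keeps the first edge, because [x] is not in [D]. The
    remaining piece meets [D] only in [w], so a path inside [D] can be appended by [linked_cat]. *)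
Lemma linked_first (S D : {set T}) x y a b :
  linked S x y a b -> y \in D -> x \notin D ->
  exists w c, [/\ w \in D, w \in S & linked ((S :\: D) :|: [set w]) x w a c].
Proof.
move=> [p [tp lp sp hp rp]] yD xD.
have hasp : has (mem D) p.
  apply/hasP; exists y => //; case: p lp {tp sp hp rp} => [/= xy|z p /= <-].
    by rewrite xy yD in xD.
  exact: mem_last.
case: (split_find hasp) tp sp hp {rp lp} => w p1 p2 wD nD tp sp hp.
have hp1 : ohead (pairmap ec x (rcons p1 w)) = Some a.
  by move: hp; rewrite pairmap_cat; case: p1 {nD tp sp}.
have [c hc] : exists c, ohead (rev (pairmap ec x (rcons p1 w))) = Some c.
  rewrite -cats1 pairmap_cat rev_cat /=; by eexists.
exists w, c; split=> //; first by apply: sp; rewrite !(inE, mem_cat, mem_rcons) eqxx !orbT.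
exists (rcons p1 w); split=> //.
- case/and3P: tp => pp; rewrite -cat_cons => up st; apply/and3P; split.
  + by move: pp; rewrite cat_path => /andP[].
  + by move: up; rewrite cat_uniq => /andP[].
  + by move: st; rewrite pairmap_cat => /cat_sorted2[].
- by rewrite last_rcons.
- move=> z zp; rewrite !inE; have [->|nzw] := eqVneq z w; first by rewrite orbT.
  rewrite orbF sp ?andbT; last by rewrite -cat_cons mem_cat zp.
  move: zp; rewrite inE mem_rcons inE (negPf nzw) /= => /orP[/eqP->//|zp].
  by move/hasPn: nD => /(_ z zp).
Qed.

Hypotheses (e_sym : symmetric e) (ec_sym : forall x y, ec x y = ec y x).

Lemma good_edge_sym : symmetric good_edge.
Proof.
by move=> x y; rewrite /good_edge /= e_sym ec_sym eq_sym; congr [&& _, _ & _]; rewrite andbC.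
Qed.

Lemma pairmap_rev x p :
  pairmap ec (last x p) (rev (belast x p)) = rev (pairmap ec x p).
Proof.
elim: p x => [//|y p IH] x /=.
rewrite rev_cons -cats1 pairmap_cat IH rev_cons -cats1 /=; congr (_ ++ [:: _]).
by case: p {IH} => [|z p] /=; rewrite ?rev_cons ?last_rcons ec_sym.
Qed.

Lemma proper_path_rev x p : proper_path x p -> proper_path (last x p) (rev (belast x p)).
Proof.
move=> /and3P[pp up sp]; apply/and3P; split.
- by rewrite rev_path; apply: sub_path pp => u v; rewrite good_edge_sym.
- by rewrite -rev_rcons -lastI rev_uniq.
- by rewrite pairmap_rev rev_sorted; apply: sub_sorted sp => u v; rewrite neqr_sym.
Qed.

Lemma last_rev_belast (x : T) p : last (last x p) (rev (belast x p)) = x.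
Proof. by case: p => [|y p] //=; rewrite rev_cons last_rcons. Qed.

Lemma joined_sym x y : joined x y -> joined y x.
Proof.
case=> p tp <-; exists (rev (belast x p)); first exact: proper_path_rev.
exact: last_rev_belast.
Qed.

Lemma linked_sym S x y a b : linked S x y a b -> linked S y x b a.
Proof.
case=> p [tp lp sp hp rp]; exists (rev (belast x p)); rewrite -lp.
split; rewrite ?pairmap_rev ?revK //.
- exact: proper_path_rev.
- exact: last_rev_belast.
- by move=> z; rewrite -rev_rcons -lastI mem_rev; apply: sp.
Qed.

(** * Properly coloured cycles and the addition of an ear *)

Lemma cycle_colors_cat s1 s2 : cycle_colors (s1 ++ s2) =
  if s1 is x :: s1' then if s2 is z :: s2' then
    pairmap ec x (rcons s1' z) ++ pairmap ec z (rcons s2' x)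
  else cycle_colors s1 else cycle_colors s2.
Proof.
case: s1 s2 => [//|x s1] [|z s2]; first by rewrite cats0.
by rewrite /= rcons_cat /= -cat_rcons pairmap_cat last_rcons.
Qed.

Lemma proper_cycle_catC s1 s2 : proper_cycle (s1 ++ s2) = proper_cycle (s2 ++ s1).
Proof.
rewrite /proper_cycle uniq_catC -(rot_size_cat s1 s2) rot_cycle; congr [&& _, _ & _].
rewrite rot_size_cat !cycle_colors_cat; case: s1 s2 => [|x s1] [|z s2] //.
by rewrite -rot_size_cat rot_cycle.
Qed.

Lemma proper_cycle_ends_neq y c : c != [::] -> proper_cycle (y :: c) ->
  ec y (head y c) != ec (last y c) y.
Proof.
case: c => [//|z c] _ /and3P[_ _] /=.
rewrite rcons_path -cats1 pairmap_cat last_cat /= => /andP[_].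
by rewrite /neqr eq_sym.
Qed.

(** The two arcs between [y] and [w] meet at [w] in consecutive edges of the cycle, hence [a != b].
    So a path arriving at [w], whatever its last colour, can go on towards [y] along at least one
    arc. *)
Lemma proper_cycle_arcs y c1 w c2 (c := c1 ++ w :: c2) : proper_cycle (y :: c) ->
  exists a b, [/\ a != b,
    linked [set z in y :: rcons c1 w] y w (ec y (head y c)) a &
    linked [set z in w :: rcons c2 y] w y b (ec (last y c) y)].
Proof.
rewrite /proper_cycle -[y :: c]/([:: y] ++ c) /c.
rewrite -[[:: y] ++ _]/((y :: c1) ++ w :: c2) cycle_colors_cat => /and3P[uc gc cc].
have gg : path good_edge y (rcons c1 w) && path good_edge w (rcons c2 y).
  by move: gc; rewrite /= rcons_cat /= -cat_rcons cat_path last_rcons.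
have u1 : uniq (y :: rcons c1 w).
  move: uc; rewrite -cat_rcons cat_uniq => /andP[+ _]; by rewrite rcons_cons.
have u2 : uniq (w :: rcons c2 y).
  have : uniq ((w :: c2) ++ y :: c1) by rewrite uniq_catC.
  by rewrite -cat_rcons cat_uniq rcons_cons => /andP[].
set E1 := pairmap ec y _ in cc; set E2 := pairmap ec w _ in cc.
have [a [E1' E1E]] : exists a E, E1 = rcons E a.
  by rewrite /E1 -cats1 pairmap_cat /= ; do 2 eexists; rewrite cats1.
have [b [E2' E2E]] : exists b E, E2 = b :: E.
  by rewrite /E2; case: (c2) => [|z c'] /=; do 2 eexists.
have [s1 s2 nab] : [/\ sorted neqr E1, sorted neqr E2 & a != b].
  have : sorted neqr (E1 ++ E2).
    by move: cc; case: (E1 ++ E2) => [//|u s] /=; rewrite rcons_path => /andP[].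
  move=> h; split; [by case/cat_sorted2: h | by case/cat_sorted2: h |].
  move: h; rewrite E1E E2E cat_rcons; case: (E1') => [|u s] /=; first by case/andP.
  by rewrite cat_path /= => /and4P[].
exists a, b; split=> //.
- exists (rcons c1 w); split.
  + by case/andP: gg => g1 _; rewrite /proper_path g1 u1.
  + by rewrite last_rcons.
  + by move=> z; rewrite in_set.
  + by case: (c1).
  + by rewrite -/E1 E1E rev_rcons.
- exists (rcons c2 y); split.
  + by case/andP: gg => _ g2; rewrite /proper_path g2 u2.
  + by rewrite last_rcons.
  + by move=> z; rewrite in_set.
  + by rewrite -/E2 E2E.
  + rewrite -cats1 pairmap_cat rev_cat /= last_cat /=; by [].
Qed.

(** For [y] on the ear, a strong path from [x] towards [a] is followed until it meets the cycle and
    then along an arc, which preserves its first colour. Continuing strong paths from [a] or from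
    [b] along the ear itself instead prescribes the edge by which [y] is entered. Combining both
    kinds gives two paths that differ at both ends. *)
Lemma ear_strong (A : {set T}) a b s q :
  strong A -> a \in A -> b \in A -> {in s, forall z, z \notin A} ->
  {subset b :: q <= A} -> last b q = a -> proper_cycle (a :: s ++ belast b q) ->
  strong (A :|: [set z in s]).
Proof.
move=> strA aA bA sA qA lq cyc.
have sub_bel z : z \in belast b q -> z \in A.
  by move=> zq; apply: qA; rewrite lastI mem_rcons inE zq orbT.
suff key x y : x \in A :|: [set z in s] -> y \in s -> x != y ->
    exists a b c d, [/\ linked (A :|: [set z in s]) x y a b,
      linked (A :|: [set z in s]) x y c d, a != c & b != d].
  move=> x y xAs yAs nxy.
  have [ys|yNs] := boolP (y \in s); first exact: key.
  have [xs|xNs] := boolP (x \in s).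
    have [|a1 [b1 [c1 [d1 [l1 l2 n1 n2]]]]] := key y x yAs xs; first by rewrite eq_sym.
    by exists b1, a1, d1, c1; split=> //; apply: linked_sym.
  have xA : x \in A by move: xAs; rewrite !inE (negPf xNs) orbF.
  have yA : y \in A by move: yAs; rewrite !inE (negPf yNs) orbF.
  have [a1 [b1 [c1 [d1 [l1 l2 n1 n2]]]]] := strA x y xA yA nxy.
  by exists a1, b1, c1, d1; split=> //; apply: linked_sub (subsetUl _ _) _.
move=> xAs ys nxy; have yNA := sA _ ys.
have [s1 [s2 sE]] : exists s1 s2, s = s1 ++ y :: s2.
  by case/splitPr: ys => s1 s2; exists s1, s2.
(* The cycle is rotated to start at [y]; [h] and [l] below are the colours of its two edges at
   [y]. *)
pose c := s2 ++ belast b q ++ a :: s1.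
have cycy : proper_cycle (y :: c).
  by move: cyc; rewrite sE -catA -cat_cons proper_cycle_catC /= -catA.
pose C' := [set z in y :: c].
have CAs : C' \subset A :|: [set z in s].
  apply/subsetP => z; rewrite in_set in_setU !inE /c !mem_cat inE sE mem_cat inE.
  case/or4P=> [->|->|/sub_bel->|]; rewrite ?orbT //.
  by case/orP=> [/eqP->|->]; rewrite ?aA ?orbT.
pose h := ec y (head y c); pose l := ec (last y c) y.
have nhl : h != l by apply: proper_cycle_ends_neq cycy; rewrite /c; case: (s2); case: (belast _ _).
have arcs w : w \in c -> exists u v,
    [/\ u != v, linked C' w y u h & linked C' w y v l].
  move=> wc; have [c1 [c2 cE]] : exists c1 c2, c = c1 ++ w :: c2.
    by case/splitPr: wc => c1 c2; exists c1, c2.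
  have [u [v [nuv l1 l2]]] :=
    proper_cycle_arcs (eq_ind _ (fun c => proper_cycle (y :: c)) cycy _ cE).
  exists u, v; split=> //.
    apply: linked_sym; rewrite /h cE; apply: linked_sub l1.
    apply/subsetP => z; rewrite !in_set cE !inE mem_rcons mem_cat !inE.
    by case/or3P=> ->; rewrite ?orbT.
  rewrite /l cE; apply: linked_sub l2.
  apply/subsetP => z; rewrite !in_set cE !inE mem_rcons mem_cat !inE.
  by case/or3P=> ->; rewrite ?orbT.
have [xc|xNc] := boolP (x \in c).
  have [u [v [nuv l1 l2]]] := arcs x xc.
  by exists u, h, v, l; split=> //; apply: linked_sub CAs _.
have xA : x \in A.
  move: xAs xNc; rewrite in_setU in_set sE /c !mem_cat !inE (negPf nxy) /=.
  by do ![case: (x \in _) => //=]; rewrite ?orbT.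
have ac : a \in c by rewrite /c !mem_cat inE eqxx !orbT.
have nxa : x != a by apply: contraNneq xNc => ->.
have cb : c = s2 ++ b :: (q ++ s1).
  by rewrite /c -[b :: _]/((b :: q) ++ s1) [b :: q]lastI lq cat_rcons.
have nxb : x != b by apply: contraNneq xNc => ->; rewrite cb mem_cat inE eqxx orbT.
have xNC : x \notin C' by rewrite in_set inE negb_or nxy.
have aC : a \in C' by rewrite in_set inE ac orbT.
(* The first colour [u] is kept; whether [y] is entered by [h] or by [l] depends on which arc is
   open at the point [w] where the cycle is met. *)
have reach u v : linked A x a u v -> exists2 w, (w == h) || (w == l) &
    linked (A :|: [set z in s]) x y u w.
  move=> /linked_first /(_ aC xNC) [w [f [wC wA lw]]].
  have wc : w \in c.
    move: wC; rewrite in_set inE => /predU1P[wy|//].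
    by rewrite wy (negPf yNA) in wA.
  have [g1 [g2 [n12 l1 l2]]] := arcs w wc.
  have subU : (A :\: C' :|: [set w]) :|: C' \subset A :|: [set z in s].
    rewrite !subUset CAs andbT; apply/andP; split.
      by apply: subset_trans (subsetDl _ _) (subsetUl _ _).
    by rewrite sub1set in_setU wA.
  have subI : (A :\: C' :|: [set w]) :&: C' \subset [set w].
    by apply/subsetP => z; rewrite in_setI in_setU in_setD => /andP[/orP[/andP[/negPf->]|->]].
  have [fg1|nfg1] := eqVneq f g1.
    exists l; rewrite ?eqxx ?orbT //; apply: linked_sub subU _.
    by apply: linked_cat lw l2 _ subI; rewrite fg1.
  exists h; rewrite ?eqxx ?orbT //; apply: linked_sub subU _.
  exact: linked_cat lw l1 nfg1 subI.
have dA t z : z \in A -> z \in s -> t by move=> zA /sA; rewrite zA.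
have [a1 [b1 [a2 [b2 [l1 l2 n1 n2]]]]] := strA x a xA aA nxa.
have [r1 hr1 R1] := reach _ _ l1; have [r2 hr2 R2] := reach _ _ l2.
(* Along the ear from [a], the vertex [y] is entered by the edge coloured [l]. The two strong paths
   from [x] to [a] end in different colours, so one of them can be continued this way. The same from
   [b] gives [h]. *)
have [gA RA] : exists g, linked (A :|: [set z in s]) x y g l.
  have cE : c = (s2 ++ belast b q) ++ a :: s1 by rewrite /c catA.
  have [u [v [_ _ la]]] :=
    proper_cycle_arcs (eq_ind _ (fun c => proper_cycle (y :: c)) cycy _ cE).
  rewrite -cE -/l in la.
  have subU : A :|: [set z in a :: rcons s1 y] \subset A :|: [set z in s].
    rewrite subUset subsetUl; apply/subsetP=> z.
    rewrite in_set in_setU in_set inE mem_rcons sE mem_cat !inE.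
    by case/or3P=> [/eqP->|->|->]; rewrite ?aA ?orbT.
  have subI : A :&: [set z in a :: rcons s1 y] \subset [set a].
    apply/subsetP=> z; rewrite in_setI in_set in_set1 inE mem_rcons inE.
    case/andP=> zA /or3P[//|/eqP zy|zs1]; first by rewrite -zy zA in yNA.
    by apply: (dA _ z zA); rewrite sE mem_cat zs1.
  have [bv|nbv] := eqVneq b1 v.
    exists a2; apply: linked_sub subU _; apply: linked_cat l2 la _ subI.
    by rewrite -bv eq_sym.
  by exists a1; apply: linked_sub subU _; apply: linked_cat l1 la nbv subI.
have [gB RB] : exists g, linked (A :|: [set z in s]) x y g h.
  have [u [v [_ /linked_sym lb _]]] :=
    proper_cycle_arcs (eq_ind _ (fun c => proper_cycle (y :: c)) cycy _ cb).
  rewrite -cb -/h in lb.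
  have subU : A :|: [set z in y :: rcons s2 b] \subset A :|: [set z in s].
    rewrite subUset subsetUl; apply/subsetP=> z.
    rewrite in_set in_setU in_set inE mem_rcons sE mem_cat !inE.
    by case/or3P=> [->|/eqP->|->]; rewrite ?bA ?orbT.
  have subI : A :&: [set z in y :: rcons s2 b] \subset [set b].
    apply/subsetP=> z; rewrite in_setI in_set in_set1 inE mem_rcons inE.
    case/andP=> zA /or3P[/eqP zy|//|zs2]; first by rewrite -zy zA in yNA.
    by apply: (dA _ z zA); rewrite sE mem_cat inE zs2 !orbT.
  have [b3 [c3 [b4 [c4 [l3 l4 n3 n4]]]]] := strA x b xA bA nxb.
  have [cu|ncu] := eqVneq c3 u.
    exists b4; apply: linked_sub subU _; apply: linked_cat l4 lb _ subI.
    by rewrite -cu eq_sym.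
  by exists b3; apply: linked_sub subU _; apply: linked_cat l3 lb ncu subI.
(* [RA] and [RB] enter [y] from different sides, [R1] and [R2] leave [x]
   differently: some pair among them differs at both ends. *)
have [gAB|nAB] := eqVneq gA gB; last by exists gA, l, gB, h; split; rewrite // eq_sym.
have [g [r [ng hr R]]] : exists g r, [/\ g != gA, (r == h) || (r == l) &
    linked (A :|: [set z in s]) x y g r].
  have [a1g|na1] := eqVneq a1 gA; last by exists a1, r1.
  by exists a2, r2; split=> //; rewrite -a1g eq_sym.
case/orP: hr => /eqP rE; rewrite rE in R.
  by exists g, h, gA, l.
by exists g, l, gA, h; split; rewrite // ?gAB // eq_sym.
Qed.

End FullyProperPaths.

(** Used with [sg] the identity when a colouring is extended without change on the old vertices, and
    with [sg] a permutation of the colours on the far side of a bridge. *)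
Lemma proper_path_map (T : finType) (C : eqType) (sg : C -> C) (S : {pred T})
    (e e' : rel T) (vc vc' : T -> C) (ec ec' : T -> T -> C) x p :
  injective sg -> {in S, forall u, vc' u = sg (vc u)} ->
  {in S &, forall u v, ec' u v = sg (ec u v)} -> {in S &, subrel e e'} ->
  {subset x :: p <= S} -> proper_path e vc ec x p ->
  proper_path e' vc' ec' x p /\ pairmap ec' x p = map sg (pairmap ec x p).
Proof.
move=> sgI hv he hee' pS /and3P[gp up sp].
have E : pairmap ec' x p = map sg (pairmap ec x p).
  elim: p x pS {gp up sp} => [//|z p IH] x pS /=.
  rewrite IH ?he ?pS ?inE ?eqxx ?orbT // => t tp.
  by apply: pS; rewrite inE tp orbT.
split=> //; apply/and3P; split=> //.
  apply: (@sub_in_path _ S) gp; last exact/allP.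
  move=> u v uS vS /and4P[euv n1 n2 n3].
  by rewrite /good_edge /= !hv // he // !(inj_eq sgI) hee' // n1 n2.
by rewrite E sorted_map; apply: sub_sorted sp => u v; rewrite /neqr /= (inj_eq sgI).
Qed.

(** * Colour words along an ear *)

Section EarWords.
Variable C : finType.

(* The colours met along an ear from [v] to [w]: [vs] for the inner vertices,
   [fs] for the edges, so [size fs = (size vs).+1]. *)
Fixpoint proper_word (v : C) vs fs w : bool :=
  match vs, fs with
  | [::], [:: f] => [&& v != w, f != v & f != w]
  | v' :: vs', f :: fs' => [&& v != v', f != v, f != v' & proper_word v' vs' fs' w]
  | _, _ => false
  end.

Definition ear_word k v w f g := exists vs fs,
  [/\ size vs = k, proper_word v vs fs w, sorted (@neqr C) fs,
      ohead fs = Some f & ohead (rev fs) = Some g].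

(* Inserting one more turn of the pattern v f c v f c at the start. *)
Lemma ear_word_add3 k v w f g :
  ear_word k.+1 v w f g -> ear_word k.+4 v w f g.
Proof.
case=> -[|c vs] [[|f' fs] [] //= [sz] /and4P[n1 n2 n3 wg] sfs [ff'] hg].
exists [:: c, f, v, c & vs], [:: f, v, c, f & fs]; move: n1 n2 n3 sfs hg.
rewrite ff' => n1 n2 n3 sfs hg; split=> //.
- by rewrite /= sz.
- rewrite /= wg ![c == _]eq_sym ![v == f]eq_sym n1 n2 n3 /= ?andbT.
  by rewrite ?n1 ?n2 ?n3 1?eq_sym ?n1 ?n2 ?n3.
- by rewrite /= sfs /neqr n2 n1 eq_sym n3.
- by move: hg; rewrite !rev_cons; case: (rev fs).
Qed.

Lemma ear_word_ind3 k v w f g :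
  ear_word 1 v w f g -> ear_word 2 v w f g -> ear_word 3 v w f g ->
  ear_word k.+1 v w f g.
Proof.
(* The inserted pattern has length three, so the induction carries three consecutive lengths. *)
move=> h1 h2 h3; suff [] : [/\ ear_word k.+1 v w f g, ear_word k.+2 v w f g &
  ear_word k.+3 v w f g] by [].
by elim: k => // k [IH1 IH2 IH3]; split=> //; apply: ear_word_add3.
Qed.

Lemma ear_word_eq k v x y z :
  uniq [:: v; x; y; z] -> ear_word k.+1 v v x y.
Proof.
rewrite /= !inE !negb_or !andbT => /and3P[/and3P[n1 n2 n3] /andP[n4 n5] n6].
have [m1 m2 m3] : [/\ x != v, y != v & z != v] by rewrite ![_ == v]eq_sym.
have [m4 m5 m6] : [/\ y != x, z != x & z != y].
  by rewrite ![_ == x]eq_sym [z == y]eq_sym.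
(* Both orientations of every inequality, so that the explicit words with one, two and three inner
   vertices are checked by rewriting. *)
have E := (n1, n2, n3, n4, n5, n6, m1, m2, m3, m4, m5, m6).
apply: ear_word_ind3.
- by exists [:: z], [:: x; y]; split; rewrite //= /neqr ?E.
- by exists [:: y; x], [:: x; z; y]; split; rewrite //= /neqr ?E.
- by exists [:: y; v; z], [:: x; z; x; y]; split; rewrite //= /neqr ?E.
Qed.

(** When the ends have different colours, the end edges cannot be prescribed freely: with four
    colours and a single inner vertex, one end edge must repeat the colour of the opposite end. Here
    the first edge does so, with [w]. *)
Lemma ear_word_neq k v w x y :
  uniq [:: v; w; x; y] -> ear_word k.+1 v w w x.
Proof.
rewrite /= !inE !negb_or !andbT => /and3P[/and3P[n1 n2 n3] /andP[n4 n5] n6].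
have [m1 m2 m3] : [/\ w != v, x != v & y != v] by rewrite ![_ == v]eq_sym.
have [m4 m5 m6] : [/\ x != w, y != w & y != x].
  by rewrite ![_ == w]eq_sym [y == x]eq_sym.
have E := (n1, n2, n3, n4, n5, n6, m1, m2, m3, m4, m5, m6).
apply: ear_word_ind3.
- by exists [:: y], [:: w; x]; split; rewrite //= /neqr ?E.
- by exists [:: x; v], [:: w; y; x]; split; rewrite //= /neqr ?E.
- by exists [:: x; w; y], [:: w; y; v; x]; split; rewrite //= /neqr ?E.
Qed.

Lemma fresh_color (s : seq C) : size s < #|C| -> exists x, x \notin s.
Proof.
move=> hs; case: (pickP (predC (mem s))) => [x xs|h]; first by exists x.
have : #|C| <= #|s|.
  by apply/subset_leq_card/subsetP => x _; move: (h x) => /negbFE.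
by move/leq_trans => /(_ _ (card_size s)); rewrite leqNgt hs.
Qed.

End EarWords.

(** * Realising a word on an ear *)

Section EarColoring.
Variables (T C : finType) (e : rel T).
Hypotheses (e_sym : symmetric e) (C_big : 3 < #|C|).

Definition set_edge (ec : T -> T -> C) a b f x y :=
  if (x == a) && (y == b) || (x == b) && (y == a) then f else ec x y.

Lemma set_edge_sym ec a b f : (forall x y, ec x y = ec y x) ->
  forall x y, set_edge ec a b f x y = set_edge ec a b f y x.
Proof. by move=> h x y; rewrite /set_edge h orbC ![(y == _) && _]andbC. Qed.

Lemma pairmap_set_edge ec a b f x p : b \notin x :: p ->
  pairmap (set_edge ec a b f) x p = pairmap ec x p.
Proof.
elim: p x => [//|y p IH] x; rewrite inE negb_or => /andP[nbx bp] /=.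
rewrite IH //; congr (_ :: _); rewrite /set_edge.
move: bp; rewrite inE negb_or => /andP[nby _].
by rewrite [x == b]eq_sym [y == b]eq_sym (negPf nbx) (negPf nby) !andbF.
Qed.

(** Induction along the ear, recolouring one vertex and one edge at a time. The condition
    [(a != b) || (1 < size s)] excludes a closed ear with one inner vertex, whose two edges would
    coincide. *)
Lemma ear_coloring (vc : T -> C) (ec : T -> T -> C) a b s vs fs v w :
  (forall x y, ec x y = ec y x) ->
  uniq s -> a \notin s -> b \notin s -> s != [::] ->
  (a != b) || (1 < size s) -> size vs = size s -> proper_word v vs fs w ->
  exists vc' ec', [/\ forall x y, ec' x y = ec' y x,
    {in [predC s], vc' =1 vc},
    {in [predC s] &, ec' =2 ec},
    map vc' s = vs & pairmap ec' a (rcons s b) = fs].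
Proof.
move=> esym; elim: s a v vs fs => [//|p s IH] a v [//|v1 vs] [//|f fs].
rewrite cons_uniq => /andP[ps us].
rewrite !inE !negb_or => /andP[nap ras] /andP[nbp bs] _ hab [szv] /and4P[_ _ _ wg].
have [s0|sN] := eqVneq s [::].
  move: hab wg szv; rewrite s0 /= orbF => nab; case: vs => // wg _.
  case: fs wg => [//|g [//|//]] wg.
  exists (fun x => if x == p then v1 else vc x), (set_edge (set_edge ec p b g) a p f).
  split; [by do 2 apply: set_edge_sym| | | |].
  - by move=> x; rewrite !inE => /negPf->.
  - by move=> x y; rewrite !inE /set_edge => /negPf-> /negPf->; rewrite !andbF.
  - by rewrite /= eqxx.
  - by rewrite /= /set_edge !eqxx (negPf nbp) [b == a]eq_sym (negPf nab) !andbF.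
have [|vc' [ec' [sym' hv he mv pe]]] := IH p v1 vs fs us ps bs sN _ szv wg.
  by rewrite eq_sym nbp.
exists (fun x => if x == p then v1 else vc' x), (set_edge ec' a p f); split.
- exact: set_edge_sym.
- by move=> x; rewrite !inE negb_or => /andP[/negPf-> xs]; apply: hv.
- move=> x y; rewrite !inE !negb_or => /andP[/negPf xp xs] /andP[/negPf yp ys].
  by rewrite /set_edge xp yp !andbF /=; apply: he.
- rewrite /= eqxx -mv; congr (_ :: _); apply/eq_in_map => x xs.
  by case: eqP => // xp; rewrite -xp xs in ps.
- rewrite /= {1}/set_edge !eqxx /=; congr (_ :: _); rewrite -pe.
  case: s ps ras sN {IH us bs hab szv hv he mv pe} => [//|p2 s] ps ras _ /=.
  rewrite pairmap_set_edge; last by rewrite -rcons_cons mem_rcons inE negb_or eq_sym nbp.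
  congr (_ :: _); rewrite /set_edge eqxx /=.
  move: ps ras; rewrite !inE !negb_or => /andP[n1 _] /andP[n2 _].
  by rewrite [p2 == p]eq_sym (negPf n1) [p2 == a]eq_sym (negPf n2) !andbF.
Qed.

Lemma proper_word_good_edge (vc : T -> C) (ec : T -> T -> C) a b s : path e a (rcons s b) ->
  proper_word (vc a) (map vc s) (pairmap ec a (rcons s b)) (vc b) ->
  path (good_edge e vc ec) a (rcons s b).
Proof.
elim: s a => [|p s IH] a /=; rewrite ?andbT.
  by move=> eab /and3P[n1 n2 n3]; rewrite /good_edge /= eab n1 n2 n3.
move=> /andP[eap ps] /and4P[n1 n2 n3 wg].
by rewrite /good_edge /= eap n1 n2 n3 IH.
Qed.

Lemma linked_eq (vc : T -> C) (ec : T -> T -> C) vc' ec' (A : {set T}) x y a b :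
  {in A, vc' =1 vc} -> {in A &, ec' =2 ec} ->
  linked e vc ec A x y a b -> linked e vc' ec' A x y a b.
Proof.
move=> hv he [p [tp lp pA hp rp]].
have [tp' E] := proper_path_map (@inj_id C) hv he (in2W (fun u v h => h)) pA tp.
by exists p; split=> //; rewrite E map_id.
Qed.

Lemma strong_eq (vc : T -> C) (ec : T -> T -> C) vc' ec' (A : {set T}) :
  {in A, vc' =1 vc} -> {in A &, ec' =2 ec} ->
  strong e vc ec A -> strong e vc' ec' A.
Proof.
move=> hv he st x y xA yA nxy; have [a [b [c [d [l1 l2 n1 n2]]]]] := st x y xA yA nxy.
by exists a, b, c, d; split=> //; apply: linked_eq hv he _.
Qed.

(** The conditions on the end colours of [q] make the ear and [q] a properly coloured cycle, to
    which [ear_strong] applies. For a closed ear [q] is empty and these conditions are void; then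
    [f != g] closes the cycle. *)
Lemma ear_extend_word (vc : T -> C) (ec : T -> T -> C) (A : {set T}) a b s q f g :
  (forall x y, ec x y = ec y x) -> strong e vc ec A -> a \in A -> b \in A ->
  path e a (rcons s b) -> uniq s -> s != [::] -> {in s, forall z, z \notin A} ->
  (a != b) || (1 < size s) ->
  proper_path e vc ec b q -> {subset b :: q <= A} -> last b q = a ->
  ear_word (size s) (vc a) (vc b) f g -> f != g ->
  (forall c, ohead (pairmap ec b q) = Some c -> g != c) ->
  (forall c, ohead (rev (pairmap ec b q)) = Some c -> c != f) ->
  exists (vc' : T -> C) (ec' : T -> T -> C), (forall x y, ec' x y = ec' y x) /\
    strong e vc' ec' (A :|: [set z in s]).
Proof.
move=> esym st aA bA ps us sN sA hab tq qA lq [vs [fs [szv wg sfs hf hg]]] nfg hgq hqf.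
have nas : a \notin s by apply/negP => /sA; rewrite aA.
have nbs : b \notin s by apply/negP => /sA; rewrite bA.
have [vc' [ec' [esym' hv he mv pe]]] :=
  ear_coloring vc esym us nas nbs sN hab szv wg.
have AC x : x \in A -> x \in [predC s].
  by move=> xA; rewrite inE /=; apply/negP => /sA; rewrite xA.
have hvA : {in A, vc' =1 vc} by move=> x /AC; apply: hv.
have heA : {in A &, ec' =2 ec} by move=> x y /AC + /AC; apply: he.
exists vc', ec'; split=> //.
have [/and3P[gq uq _] Eq] :=
  proper_path_map (@inj_id C) hvA heA (in2W (fun u v h => h)) qA tq.
rewrite map_id in Eq.
have bq : rcons (belast b q) a = b :: q by rewrite lastI lq.
apply: (ear_strong e_sym esym' (strong_eq hvA heA st) aA bA sA qA lq).
apply/and3P; split.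
- suff : uniq (s ++ b :: q) by rewrite -bq -rcons_cat rcons_uniq.
  rewrite cat_uniq us uq andbT; apply/hasPn => z /qA zA.
  by apply/negP => /sA; rewrite zA.
- rewrite /= rcons_cat bq -cat_rcons cat_path last_rcons gq andbT.
  by apply: proper_word_good_edge; rewrite // mv pe !hvA.
- have -> : cycle_colors ec' (a :: s ++ belast b q) = fs ++ pairmap ec b q.
    by rewrite /= rcons_cat bq -cat_rcons pairmap_cat last_rcons pe Eq.
  have : sorted (@neqr C) (fs ++ (pairmap ec b q ++ [:: f])).
    apply: sorted_neqr_cat => //.
      apply: sorted_neqr_cat => [|//|c d /hqf ncf [<-] //].
      by case/and3P: tq.
    move=> c d; rewrite hg => -[<-].
    by case: (pairmap ec b q) hgq => [_ [<-]|c' ? h [<-]]; [rewrite eq_sym | apply: h].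
  by case: fs hf {wg sfs hg pe} => [//|f' fs] [->]; rewrite /= catA cats1.
Qed.

(* If [vc a = vc b], the end edges of the ear only need to be distinct from each
   other and from a strong path between [a] and [b]. Otherwise the first edge of
   the ear gets the colour of [b], which is possible along one of the two
   strong paths since their last edges at [a] differ. *)
Lemma ear_extend (vc : T -> C) (ec : T -> T -> C) (A : {set T}) a b s :
  (forall x y, ec x y = ec y x) -> strong e vc ec A -> a \in A -> b \in A ->
  path e a (rcons s b) -> uniq s -> s != [::] -> {in s, forall z, z \notin A} ->
  (a != b) || (1 < size s) ->
  exists (vc' : T -> C) (ec' : T -> T -> C), (forall x y, ec' x y = ec' y x) /\
    strong e vc' ec' (A :|: [set z in s]).
Proof.
move=> esym st aA bA ps us sN sA hab.
have [k szs] : exists k, size s = k.+1 by case: (s) sN => // x s' _; exists (size s').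
have fresh l : size l <= 3 -> exists x : C, x \notin l.
  by move=> hl; apply: fresh_color; apply: leq_ltn_trans hl C_big.
have [ab|nab] := eqVneq a b.
  have [x nx] := fresh [:: vc a] isT.
  have [y ny] := fresh [:: vc a; x] isT.
  have [z nz] := fresh [:: vc a; x; y] isT.
  have [nxy u4] : x != y /\ uniq [:: vc a; x; y; z].
    move: nx ny nz; rewrite /= !inE !negb_or => nx /andP[ny nyx] /and3P[n1 n2 n3].
    by rewrite [y == z]eq_sym ![x == _]eq_sym ![vc a == _]eq_sym nx ny nyx n1 n2 n3.
  apply: (@ear_extend_word vc ec A a b s [::] x y) => //.
  - by move=> t; rewrite inE => /eqP->.
  - by rewrite szs -ab; apply: ear_word_eq u4.
have nba : b != a by rewrite eq_sym.
(* The strong paths run from [b] back to [a]: [u] and [u'] are their colours at [b], [t] and [t']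
   those at [a]. *)
have [u [t [u' [t' [l1 l2 nu nt]]]]] := st b a bA aA nba.
have [vab|nvab] := eqVneq (vc a) (vc b).
  have [x nx] := fresh [:: vc a; t] isT.
  have [y ny] := fresh [:: vc a; x; u] isT.
  have [z nz] := fresh [:: vc a; x; y] isT.
  move: nx ny nz; rewrite !inE !negb_or => /andP[nx nxt] /and3P[ny nyx nyu] /and3P[n1 n2 n3].
  have u4 : uniq [:: vc a; x; y; z].
    rewrite /= !inE !negb_or [y == z]eq_sym ![x == _]eq_sym ![vc a == _]eq_sym.
    by rewrite nx ny nyx n1 n2 n3.
  case: l1 => q [tq lq qA hq rq].
  apply: (@ear_extend_word vc ec A a b s q x y) => //.
  - by rewrite szs -vab; apply: ear_word_eq u4.
  - by rewrite eq_sym.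
  - by move=> c; rewrite hq => -[<-].
  - by move=> c; rewrite rq => -[<-]; rewrite eq_sym.
have [u0 [t0 [l0 nt0]]] : exists u t, linked e vc ec A b a u t /\ t != vc b.
  have [tb|ntb] := eqVneq t (vc b); last by exists u, t.
  by exists u', t'; split=> //; rewrite -tb eq_sym.
have [x nx] := fresh [:: vc a; vc b; u0] isT.
have [y ny] := fresh [:: vc a; vc b; x] isT.
move: nx ny; rewrite !inE !negb_or => /and3P[n1 n2 n3] /and3P[n4 n5 n6].
have u4 : uniq [:: vc a; vc b; x; y].
  rewrite /= !inE !negb_or ![_ == x]eq_sym ![_ == y]eq_sym.
  by rewrite nvab n1 n2 n4 n5 n6.
case: l0 => q [tq lq qA hq rq].
apply: (@ear_extend_word vc ec A a b s q (vc b) x) => //.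
- by rewrite szs; apply: ear_word_neq u4.
- by rewrite eq_sym.
- by move=> c; rewrite hq => -[<-].
- by move=> c; rewrite rq => -[<-].
Qed.

End EarColoring.

(** * Deletion of an edge, and bridges in terms of reachability *)

Lemma eq_set2 (T : finType) (x y u v : T) :
  ([set x; y] == [set u; v]) = (x == u) && (y == v) || (x == v) && (y == u).
Proof.
apply/eqP/idP => [E|/orP[]/andP[/eqP-> /eqP->] //]; last exact: setUC.
have : x \in [set u; v] by rewrite -E set21.
have : y \in [set u; v] by rewrite -E set22.
have : u \in [set x; y] by rewrite E set21.
have : v \in [set x; y] by rewrite E set22.
rewrite !inE ![u == _]eq_sym ![v == _]eq_sym.
by case: (x == u); case: (x == v); case: (y == u); case: (y == v).
Qed.

Section Bridges.
Variable T : finType.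
Implicit Types e : rel T.

Definition remove_edge e u v : rel T := [rel x y | e x y && ([set x; y] != [set u; v])].

(** Bridges are expressed by reachability instead of a count of components, and for any relation,
    because the induction over bridges leaves the connected graphs. *)
Definition cut_edge e u v := e u v && ~~ connect (remove_edge e u v) u v.

Lemma remove_edge_sym e u v : symmetric e -> symmetric (remove_edge e u v).
Proof. by move=> es x y; rewrite /remove_edge /= es [[set x; y]]setUC. Qed.

Lemma sub_remove_edge e u v : subrel (remove_edge e u v) e.
Proof. by move=> x y /andP[]. Qed.

(** A walk can be shortened so that it crosses the edge at most once, in one of the two
    directions. *)
Lemma connect_remove_edge e a b x y (d := remove_edge e a b) :
  connect e x y ->
  [\/ connect d x y, connect d x a /\ connect d b y |
      connect d x b /\ connect d a y].
Proof.
case/connectP=> p; elim: p x => [x _ ->|z p IH x /= /andP[exz pz] ly].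
  by constructor 1; apply: connect0.
have {IH} h := IH z pz ly.
have [dxz|] := boolP (d x z).
  have trans t := @connect_trans _ d z x t (connect1 dxz).
  case: h => [h|[h1 h2]|[h1 h2]]; [constructor 1|constructor 2|constructor 3].
  - exact: trans.
  - by split=> //; apply: trans.
  - by split=> //; apply: trans.
rewrite /d /remove_edge /= exz /= negbK eq_set2.
case/orP=> /andP[/eqP xE /eqP zE]; move: h; rewrite xE zE.
  case=> [h|[_ h]|[_ h]]; [constructor 2|constructor 2|by constructor 1];
    by split=> //; apply: connect0.
case=> [h|[_ h]|[_ h]]; [constructor 3|by constructor 1|constructor 3];
  by split=> //; apply: connect0.
Qed.

(** If [u] and [v] were joined in [e] without the edge [uv], the walk would have to cross [ab]. Its
    two parts, together with [uv], would then join [a] to [b] without [ab]. *)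
Lemma bridge_remove_edge e a b u v : symmetric e ->
  cut_edge e a b -> cut_edge (remove_edge e a b) u v -> cut_edge e u v.
Proof.
move=> es /andP[eab nab] /andP[duv nuv]; rewrite /cut_edge (sub_remove_edge duv) /=.
have ds := remove_edge_sym a b es; have dds := remove_edge_sym u v ds.
apply: contra nab => /(@connect_remove_edge _ a b).
have E : connect (remove_edge (remove_edge e u v) a b) =2
    connect (remove_edge (remove_edge e a b) u v).
  by apply: eq_connect => x y; rewrite /remove_edge /= -!andbA [X in _ && X]andbC.
rewrite !E; have sub x y : connect (remove_edge (remove_edge e a b) u v) x y ->
    connect (remove_edge e a b) x y.
  by apply: connect_sub => s t /sub_remove_edge; apply: connect1.
have csym := sym_connect_sym ds.
case=> [h|[g1 g2]|[g1 g2]]; first by rewrite h in nuv.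
  have h1 := sub _ _ g1; have h2 := sub _ _ g2; rewrite csym in h1; rewrite csym in h2.
  by rewrite (connect_trans h1) // (connect_trans (connect1 duv)).
by apply: connect_trans (sub _ _ g2) (connect_trans _ (sub _ _ g1)); rewrite csym connect1.
Qed.

End Bridges.

(** * Bridgeless components, built from ears *)

Section Components.
Variables (T C : finType).
Hypothesis C_big : 3 < #|C|.
Implicit Types (e d : rel T) (vc : T -> C) (ec : T -> T -> C).

Lemma cross_edge e (A : {set T}) r z : connect e r z -> r \in A -> z \notin A ->
  exists a p, [/\ a \in A, p \notin A & e a p].
Proof.
case/connectP=> p; elim: p r => [r _ -> ->//|y p IH r /= /andP[ery py] lz rA zA].
have [yA|yA] := boolP (y \in A); first exact: IH yA zA.
by exists r, y.
Qed.

(** An edge [ap] leaving [A] is not a bridge, so a path leads from [p] back to [a] without it; it is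
    cut at its first vertex [b] in [A]. If [s] consists of [p] alone, then [b] is not [a], because
    the edge [pa] is deleted. *)
Lemma exists_ear e (A : {set T}) r z : symmetric e ->
  (forall a b, connect e r a -> e a b -> connect (remove_edge e a b) a b) ->
  r \in A -> {in A, forall x, connect e r x} -> connect e r z -> z \notin A ->
  exists a b s, [/\ a \in A, b \in A, path e a (rcons s b) & uniq s] /\
    [/\ s != [::], {in s, forall x, x \notin A} & (a != b) || (1 < size s)].
Proof.
move=> es nbr rA Ar rz zA.
have [a [p [aA pA eap]]] := cross_edge rz rA zA.
have := nbr a p (Ar a aA) eap.
rewrite (sym_connect_sym (remove_edge_sym a p es)) => /connectP[q0 pq0 lq0].
case/shortenP: pq0 lq0 => q pq uq _ lq.
have hasq : has (mem A) q.
  apply/hasP; exists a => //; case: q lq {pq uq} => [/= ap|y q /= ->].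
    by rewrite ap (negPf pA) in aA.
  exact: mem_last.
case: (split_find hasq) pq uq {lq} => b s q2 bA sA pq uq.
have {}pq : path (remove_edge e a p) p (rcons s b) by move: pq; rewrite cat_path => /andP[].
exists a, b, (p :: s); split; split=> //.
- by rewrite rcons_cons /= eap; apply: sub_path pq; apply: sub_remove_edge.
- by move: uq; rewrite cat_rcons -cat_cons cat_uniq => /andP[].
- move=> x; rewrite inE => /predU1P[->//|xs].
  by move/hasPn: sA => /(_ x xs).
- case: s pq {sA uq} => [|y s] pq; rewrite ?orbT //= orbF.
  by apply: contraTneq pq => ->; rewrite /remove_edge /= [[set p; b]]setUC eqxx andbF.
Qed.

(** Ears are added to the set [[set r]], on which [strong] is vacuous, until the component is
    exhausted; [n] bounds the number of vertices outside [A]. *)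
Lemma strong_component e r : symmetric e ->
  (forall a b, connect e r a -> e a b -> connect (remove_edge e a b) a b) ->
  exists vc ec, (forall x y, ec x y = ec y x) /\
    strong e vc ec [set x | connect e r x].
Proof.
move=> es nbr.
have /card_gt0P[c0 _] : 0 < #|C| by apply: leq_trans C_big.
suff grow n : forall A vc ec, #|~: A| <= n -> (forall x y, ec x y = ec y x) ->
    strong e vc ec A -> r \in A -> {in A, forall x, connect e r x} ->
    exists vc ec, (forall x y, ec x y = ec y x) /\
      strong e vc ec [set x | connect e r x].
  apply: (grow _ [set r] (fun=> c0) (fun _ _ => c0) (leqnn _)) => //.
  - by move=> x y /set1P-> /set1P->; rewrite eqxx.
  - exact: set11.
  - by move=> x /set1P->; apply: connect0.
elim: n => [|n IH] A vc ec nA esym st rA Ar.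
  exists vc, ec; split=> //; have -> : [set x | connect e r x] = A => //.
  apply/setP => x; rewrite inE; apply/idP/idP; last exact: Ar.
  by move=> _; move: nA; rewrite leqn0 cards_eq0 => /eqP/setP/(_ x); rewrite !inE => /negbFE.
have [sub|] := boolP ([set x | connect e r x] \subset A).
  exists vc, ec; split=> //; have -> : [set x | connect e r x] = A => //.
  by apply/eqP; rewrite eqEsubset sub; apply/subsetP => x /Ar; rewrite inE.
case/subsetPn=> z; rewrite inE => rz zA.
have [a [b [s [[aA bA ps us] [sN sA hab]]]]] := exists_ear es nbr rA Ar rz zA.
have [vc' [ec' [esym' st']]] := ear_extend es C_big esym st aA bA ps us sN sA hab.
apply: IH esym' st' _ _.
- rewrite -ltnS; apply: leq_trans nA; apply: proper_card.
  rewrite properEneq setCS subsetUl andbT.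
  case: s sN sA {ps us hab} => [//|p s] _ sA.
  apply/eqP => /setP/(_ p); rewrite !inE eqxx /= orbT /= => h.
  by have := sA p (mem_head _ _); rewrite -h.
- by rewrite in_setU rA.
- move=> x; rewrite in_setU in_set => /orP[/Ar//|xs].
  have := Ar a aA => /connect_trans; apply.
  by apply: (path_connect ps); rewrite inE mem_rcons inE xs !orbT.
Qed.

(** * Joining the two sides of a bridge *)

Lemma joined_refl e vc ec x : joined e vc ec x x.
Proof. by exists [::]. Qed.

Lemma free_color e vc ec a : #|[set y | e a y]|.+1 < #|C| ->
  exists k, k != vc a /\ forall y, e a y -> ec a y != k.
Proof.
move=> h; have [|k] := @fresh_color C (vc a :: [seq ec a y | y <- enum [set y | e a y]]).
  by rewrite /= size_map -cardE.
rewrite inE negb_or => /andP[n1 n2]; exists k; split=> // y eay.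
apply: contraNneq n2 => <-; apply/mapP; exists y => //.
by rewrite mem_enum inE.
Qed.

Lemma exists_recoloring (k b k' b' : C) : k != b -> k' != b' ->
  exists2 sg : C -> C, injective sg & sg k = k' /\ sg b = b'.
Proof.
move=> nkb nkb'.
(* The inner transposition takes [k] to [k']; the outer one moves the image of [b] to [b'] and fixes
   [k']. *)
exists (tperm (tperm k k' b) b' \o tperm k k').
  by apply: inj_comp; apply: perm_inj.
rewrite /= tpermL; split; last by rewrite tpermL.
rewrite tpermD //; last by rewrite eq_sym.
by rewrite -{2}(tpermL k k') (inj_eq perm_inj) eq_sym.
Qed.

Lemma proper_path_last_edge e vc ec x p c : proper_path e vc ec x p ->
  ohead (rev (pairmap ec x p)) = Some c ->
  exists2 u, e u (last x p) & c = ec u (last x p).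
Proof.
case/and3P=> + _ _; case/lastP: p => [//|p y].
rewrite rcons_path -cats1 pairmap_cat rev_cat last_cat /= => /andP[_ /and4P[ey _ _ _]] [<-].
by exists (last x p).
Qed.

Lemma proper_path_connect e vc ec x p : proper_path e vc ec x p ->
  {subset x :: p <= connect e x}.
Proof.
case/and3P=> gp _ _ z zp; apply: (path_connect _ zp).
by apply: sub_path gp => u v /and4P[].
Qed.

Lemma glue_bridge e d a b vc1 ec1 vc2 ec2 :
  symmetric e -> symmetric d -> subrel d e -> e a b -> ~~ connect d a b ->
  #|[set y | d a y]|.+1 < #|C| -> #|[set y | d b y]|.+1 < #|C| ->
  (forall x y, ec1 x y = ec1 y x) -> (forall x y, ec2 x y = ec2 y x) ->
  (forall x y, connect d a x -> connect d a y -> joined d vc1 ec1 x y) ->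
  (forall x y, connect d b x -> connect d b y -> joined d vc2 ec2 x y) ->
  exists vc ec, (forall x y, ec x y = ec y x) /\
    forall x y, connect d a x || connect d b x -> connect d a y || connect d b y ->
      joined e vc ec x y.
Proof.
move=> es ds sde eab nab da db sym1 sym2 J1 J2.
have [k1 [nk1 fr1]] := free_color vc1 ec1 da.
have [k2 [nk2 fr2]] := free_color vc2 ec2 db.
(* [z] will be the colour of [b]: it must differ from the colour [k1] of the bridge and from that of
   [a]. So the permutation is prescribed at two colours, taking [k2] to [k1] and the colour of [b]
   to [z]. *)
have [z nz] : exists z, z \notin [:: k1; vc1 a].
  by apply: fresh_color; apply: ltn_trans C_big.
move: nz; rewrite !inE negb_or => /andP[nzk nza].
have nk1z : k1 != z by rewrite eq_sym.
have [sg sgI [sgk sgb]] := exists_recoloring nk2 nk1z.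
have cs := sym_connect_sym ds.
have disj x : connect d a x -> connect d b x -> False.
  by move=> ax bx; move: nab; rewrite (connect_trans ax) // cs.
pose B := connect d b.
have NB x : connect d a x -> B x = false by move=> ax; apply/negP => /(disj x ax).
pose vc x := if B x then sg (vc2 x) else vc1 x.
pose ec0 x y := if B x && B y then sg (ec2 x y) else ec1 x y.
pose ec := set_edge ec0 a b k1.
have sym : forall x y, ec x y = ec y x.
  by apply: set_edge_sym => x y; rewrite /ec0 andbC sym1 sym2.
have Bb : B b by apply: connect0.
have Ba : B a = false by apply: NB; apply: connect0.
have ec1E : {in connect d a &, forall u v, ec u v = ec1 u v}.
  move=> u v /NB Bu /NB Bv; rewrite /ec /set_edge /ec0 Bu Bv.
  have [ub|_] := eqVneq u b; first by rewrite ub Bb in Bu.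
  have [vb|_] := eqVneq v b; first by rewrite vb Bb in Bv.
  by rewrite !andbF.
have vc1E : {in connect d a, forall u, vc u = vc1 u}.
  by move=> u /NB Bu; rewrite /vc Bu.
have ec2E : {in B &, forall u v, ec u v = sg (ec2 u v)}.
  move=> u v uB vB; have [Bu Bv] : B u /\ B v by [].
  rewrite /ec /set_edge /ec0 Bu Bv.
  have [ua|_] := eqVneq u a; first by rewrite ua Ba in Bu.
  have [va|_] := eqVneq v a; first by rewrite va Ba in Bv.
  by rewrite !andbF.
have vc2E : {in B, forall u, vc u = sg (vc2 u)}.
  by move=> u uB; rewrite /vc (_ : B u).
have sub x p w (wx : connect d w x) vc' ec' : proper_path d vc' ec' x p ->
    {subset x :: p <= connect d w}.
  by move=> /proper_path_connect h t /h; apply: connect_trans wx.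
have P1 x p : connect d a x -> proper_path d vc1 ec1 x p ->
    proper_path e vc ec x p /\ pairmap ec x p = pairmap ec1 x p.
  move=> ax tp; rewrite -[pairmap ec1 x p]map_id.
  by apply: proper_path_map (@inj_id C) vc1E ec1E (in2W sde) (sub _ _ _ ax _ _ tp) tp.
have P2 x p : connect d b x -> proper_path d vc2 ec2 x p ->
    proper_path e vc ec x p /\ pairmap ec x p = map sg (pairmap ec2 x p).
  move=> bx tp.
  by apply: proper_path_map sgI vc2E ec2E (in2W sde) (sub _ _ _ bx _ _ tp) tp.
exists vc, ec; split=> //.
have J12 x y : connect d a x -> connect d b y -> joined e vc ec x y.
  move=> ax by_; have [p tp lp] := J1 x a ax (connect0 _ _).
  have [q tq lq] := J2 b y (connect0 _ _) by_.
  have [tp' Ep] := P1 x p ax tp; have [tq' Eq] := P2 b q (connect0 _ _) tq.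
  have sp := sub _ _ _ ax _ _ tp; have sq := sub _ _ _ (connect0 _ _) _ _ tq.
  have nba : a \notin b :: q.
    by apply/negP => /sq /(disj a (connect0 _ _)).
  have ecab : ec a b = k1 by rewrite /ec /set_edge !eqxx.
  have tabq : proper_path e vc ec a (b :: q).
    apply: (@proper_path_cat _ _ _ _ _ a [:: b] q) => //.
    - rewrite /proper_path /= !andbT /good_edge /= eab ecab /vc Bb Ba sgb.
      move: nba; rewrite !inE negb_or => /andP[-> _].
      by rewrite eq_sym nza nk1 nk1z.
    - rewrite disjoint_cons; move: nba; rewrite inE negb_or => /andP[_ ->] /=.
      by rewrite disjoint_cons disjoint0 andbT; case/and3P: tq => _ /andP[].
    (* No edge at [b] had colour [k2], so after the permutation none of them has [k1]. *)
    - move=> c c' /= [<-]; rewrite ecab Eq.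
      case: q tq {sq lq tq' Eq nba} => [//|u q] /and3P[/= /andP[/and4P[dbu _ _ _] _] _ _] [<-].
      by rewrite -sgk (inj_eq sgI) eq_sym fr2.
  exists (p ++ b :: q); last by rewrite last_cat.
  apply: proper_path_cat => //; rewrite ?lp //.
    rewrite disjoint_has; apply/hasPn => t /sp at_.
    by apply/negP => /sq /(disj t at_).
  move=> c c'; rewrite Ep => /(proper_path_last_edge tp)[u du ->] /= [<-].
  by rewrite ecab lp sym1 fr1 // ds -lp.
move=> x y /orP[ax|bx] /orP[ay|by_].
- have [p tp lp] := J1 x y ax ay; exists p => //; by case: (P1 x p ax tp).
- exact: J12.
- by apply: joined_sym => //; apply: J12.
- have [p tp lp] := J2 x y bx by_; exists p => //; by case: (P2 x p bx tp).
Qed.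

(** Induction on the number of edges, counted as ordered pairs. One component of an arbitrary
    relation is coloured at a time, since deleting a bridge disconnects; the degree condition is
    inherited by [bridge_remove_edge]. *)
Lemma color_component e r : symmetric e ->
  (forall u v, cut_edge e u v -> #|[set y | e u y]| < #|C|) ->
  exists vc ec, (forall x y, ec x y = ec y x) /\
    forall x y, connect e r x -> connect e r y -> joined e vc ec x y.
Proof.
have [n] := ubnP #|[set uv : T * T | e uv.1 uv.2]|.
elim: n e r => // n IH e r le_n es hdeg.
have cs := sym_connect_sym es.
have [/existsP[a /existsP[b /andP[ra bab]]]|nbr] :=
  boolP [exists a, exists b, connect e r a && cut_edge e a b]; last first.
  have [|vc [ec [esym st]]] := @strong_component e r es.
    move=> a b ra eab; apply: contraNT nbr => nab.
    by apply/existsP; exists a; apply/existsP; exists b; rewrite ra /cut_edge eab.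
  exists vc, ec; split=> // x y rx ry.
  have [->|nxy] := eqVneq x y; first exact: joined_refl.
  have [||c1 [c2 [c3 [c4 [h _ _ _]]]]] := st x y _ _ nxy; rewrite ?inE //.
  exact: linked_joined h.
pose d := remove_edge e a b; have ds : symmetric d by apply: remove_edge_sym.
have [eab nab] := andP bab.
have bba : cut_edge e b a.
  rewrite /cut_edge es eab /=.
  have -> : connect (remove_edge e b a) =2 connect d.
    by apply: eq_connect => x y; rewrite /d /remove_edge /= [[set b; a]]setUC.
  by rewrite (sym_connect_sym ds).
(* The ends of the deleted bridge lose one from their degree, which gives the room that [free_color]
   requires. *)
have dege u v : e u v -> ~~ d u v -> #|[set y | d u y]|.+1 <= #|[set y | e u y]|.
  move=> euv nduv; apply/proper_card/properP; split.
    by apply/subsetP => y; rewrite !inE => /sub_remove_edge.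
  by exists v; rewrite inE.
have dn : #|[set uv : T * T | d uv.1 uv.2]| < n.
  rewrite -ltnS; apply: leq_trans le_n; rewrite ltnS; apply/proper_card/properP; split.
    by apply/subsetP => y; rewrite !inE => /sub_remove_edge.
  by exists (a, b); rewrite inE //= /d /remove_edge /= eqxx andbF.
have hdegd u v : cut_edge d u v -> #|[set y | d u y]| < #|C|.
  move=> /(bridge_remove_edge es bab) /hdeg; apply: leq_ltn_trans.
  by apply/subset_leq_card/subsetP => y; rewrite !inE => /sub_remove_edge.
have [vc1 [ec1 [sym1 J1]]] := IH d a dn ds hdegd.
have [vc2 [ec2 [sym2 J2]]] := IH d b dn ds hdegd.
have ndab : ~~ d a b by rewrite /d /remove_edge /= eqxx andbF.
have ndba : ~~ d b a by rewrite ds.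
have da := leq_ltn_trans (dege _ _ eab ndab) (hdeg _ _ bab).
have eba : e b a by rewrite es.
have db := leq_ltn_trans (dege _ _ eba ndba) (hdeg _ _ bba).
have [vc [ec [esym J]]] :=
  glue_bridge es ds (@sub_remove_edge _ e a b) eab nab da db sym1 sym2 J1 J2.
exists vc, ec; split=> // x y rx ry.
(* The component of [r] in [e] is covered by the components of [a] and [b] in [d]. *)
suff h z : connect e r z -> connect d a z || connect d b z by apply: J; apply: h.
move=> rz; have : connect e a z by rewrite (connect_trans _ rz) // cs.
case/(@connect_remove_edge _ _ a b) => [->//|[_ ->]|[_ ->]//]; exact: orbT.
Qed.

End Components.

(** * From symmetric edge colours to total-colourings of graphs *)

Lemma cut_edge_bridge (G : sgraph) (u v : G) : gconnected G ->
  cut_edge (@sedge G) u v -> bridge u v.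
Proof.
move=> [_ conn] /andP[euv nuv]; rewrite /bridge euv /=.
have ds := remove_edge_sym u v (@sedge_sym G).
have cs := sym_connect_sym (@sedge_sym G).
have cds := sym_connect_sym ds.
have -> : n_comp (@sedge G) predT = 1.
  rewrite -(n_comp_connect cs u); apply: eq_n_comp_r => x.
  by rewrite [RHS]conn.
(* After the deletion [u] and [v] lie in two different components, while the connected graph has
   one. *)
have := n_comp_closure2 cds u v; rewrite nuv => <-.
apply/subset_leq_card/subsetP => x; rewrite !inE => /andP[-> _].
by rewrite andbT.
Qed.

Section TotalColoring.
Variables (G : sgraph) (C : eqType) (vc : G -> C) (ec : G -> G -> C) (c0 : C).
Hypothesis ec_sym : forall x y, ec x y = ec y x.

(** Turns colours of ordered pairs into colours of sets; by the symmetry of [ec] it does not matter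
    which ordering is picked. [c0] is the default for sets not of the form [[set x; y]]. *)
Definition set_ecol (S : {set G}) : C :=
  if [pick p : G * G | [set p.1; p.2] == S] is Some p then ec p.1 p.2 else c0.

Lemma set_ecolE x y : set_ecol [set x; y] = ec x y.
Proof.
rewrite /set_ecol; case: pickP => [[u v] /=|/(_ (x, y))]; last by rewrite eqxx.
by rewrite eq_set2 => /orP[]/andP[/eqP-> /eqP->].
Qed.

Lemma proper_path_total_proper x p : proper_path (@sedge G) vc ec x p ->
  total_proper_path (TotalColoring vc set_ecol) x p.
Proof.
case/and3P=> gp up sp; have gpP := pathP x gp.
have ep : path (@sedge G) x p by apply: sub_path gp => u v /and4P[].
split; first by rewrite ep.
- move=> i /=; rewrite !ltnS => lti; rewrite !set_ecolE.
  have := sortedP (ec x x) sp; rewrite size_pairmap => /(_ i lti).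
  by rewrite /neqr !(nth_pairmap x) ?(ltnW lti).
- move=> i _ /=; rewrite !ltnS => lti.
  by have /and4P[] := gpP i (ltnW lti).
- move=> i /=; rewrite !ltnS => lti; rewrite !set_ecolE.
  have /and4P[_ _ _ n1] := gpP i (ltnW lti).
  have /and4P[_ _ n2 _] := gpP i.+1 lti.
  by rewrite eq_sym; split=> //; rewrite eq_sym.
Qed.

End TotalColoring.

(** The component of any vertex is the whole graph, and every endpoint of a bridge has degree at
    most [bridge_max_degree G], so [k] colours meet the conditions of [color_component]. Both bounds
    of the theorem are instances. *)
Lemma tpc_le (G : sgraph) (hG : gconnected G) k :
  3 < k -> bridge_max_degree G < k -> tpc hG <= k.
Proof.
move=> k3 hk; rewrite /tpc; case: ex_minnP => m _; apply; apply/asboolP.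
have [/card_gt0P[r _] conn] := hG.
have [||vc [ec [esym J]]] := @color_component G 'I_k _ (@sedge G) r (@sedge_sym G).
- by rewrite card_ord.
- move=> u v /(cut_edge_bridge hG) buv; rewrite card_ord; apply: leq_ltn_trans hk.
  apply: (@leq_bigmax_cond _ _ (@degree G)); by apply/existsP; exists v.
exists (TotalColoring vc (set_ecol ec (vc r))) => x y _.
have [p tp lp] := J x y (conn r x) (conn r y).
by exists p; split=> //; apply: proper_path_total_proper.
Qed.

Theorem theorem4 (G : sgraph) (hG : gconnected G) :
  (4 <= bridge_max_degree G -> tpc hG <= bridge_max_degree G + 1) /\
  (bridge_max_degree G < 4 -> tpc hG <= 4).
Proof.
split=> h; last exact: tpc_le.
by apply: tpc_le; rewrite addn1 // ltnS; apply: ltnW.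
Qed.
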